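(* (1) $\mathbf{QL}(\mathbb{C}^2)\neq \mathbf{QL}(\mathbb{C}^4)$. (2) For every integer $i\geq 0$ there exists an equation $\beta$ (between two terms) such that $\beta\in \mathbf{QL}(\mathbb{C}^{2^k})$ for every integer $0\le k\leq i$, and $\beta\notin \mathbf{QL}(\mathbb{C}^{2^l})$ for every integer $l>i$.
   Context: For a Hilbert space $\mathbb{H}$, let $L_c(\mathbb{H})$ be the set of all closed subspaces of $\mathbb{H}$, ordered by inclusion, with meet $p\wedge q=p\cap q$, join $p\vee q=$ the closure of the span of $p\cup q$, and negation $\bar p=$ the orthogonal complement of $p$; write $\mathbf{0}=\{0\}$ and $\mathbf{1}=\mathbb{H}$. A term $T(p,q,\dots,r)$ is any formula in finitely many variables built using the connectives $\wedge,\vee,\bar{\ }$. An equation $T_1(p,\dots,r)=T_2(p,\dots,r)$ is true in $L_c(\mathbb{H})$ if the values of $T_1$ and $T_2$ agree for all assignments of the variables to elements of $L_c(\mathbb{H})$. The quantum logic $\mathbf{QL}(\mathbb{H})$ is the set (variety) of all equations true in $L_c(\mathbb{H})$. *)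

(* Defs.v *)
From HB Require Import structures.
From mathcomp Require Import all_boot all_order all_algebra.
From mathcomp Require Import complex spectral.
From mathcomp Require Import boolp classical_sets reals topology normedtype.
Import GRing.Theory Num.Theory numFieldNormedType.Exports.

Set Implicit Arguments.
Unset Strict Implicit.
Unset Printing Implicit Defensive.

Local Open Scope ring_scope.
Local Open Scope classical_set_scope.

(* The field R[i] seen as a [numClosedFieldType]; it is through this structure
   that row vectors over it inherit the library's norm topology. *)
Definition Cplx (R : realType) : numClosedFieldType := R[i]%C.

Inductive term : Type :=
  | Var of nat
  | Meet of term & term
  | Join of term & term
  | Neg of term.

Definition equation : Type := (term * term)%type.

Section QuantumLogic.
Variables (C : numClosedFieldType) (n : nat).
Implicit Types (p q : set 'rV[C]_n).

Definition is_subspace p : Prop :=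
  p 0 /\ forall (a : C) (x y : 'rV[C]_n), p x -> p y -> p (a *: x + y).

Definition Lc : set (set 'rV[C]_n) := [set p | is_subspace p /\ closed p].

Definition lspan p : set 'rV[C]_n := smallest is_subspace p.

Definition meet p q : set 'rV[C]_n := p `&` q.

Definition join p q : set 'rV[C]_n := closure (lspan (p `|` q)).

(* [dotmx] is the standard Hermitian inner product \sum_j x_j * (y_j)^* *)
Definition orthocompl p : set 'rV[C]_n :=
  [set x | forall y, p y -> dotmx x y = 0].

Lemma closure_is_subspace p : is_subspace p -> is_subspace (closure p).
Proof.
move=> [p0 pD]; split; first exact: subset_closure.
move=> a x y px py B nB.
have cf : (fun z : 'rV[C]_n * 'rV[C]_n => a *: z.1 + z.2) @ (x, y)
          --> a *: x + y.
  by apply: cvgD; [apply: cvgZr; exact: cvg_fst|exact: cvg_snd].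
have [[U W] [/= nU nW] UWB] := cf _ nB.
have [u [pu Uu]] := px _ nU; have [w [pw Ww]] := py _ nW.
by exists (a *: u + w); split; [exact: pD|exact: (UWB (u, w))].
Qed.

Lemma lspan_is_subspace p : is_subspace (lspan p).
Proof.
split; first by move=> A [[A0 _] _].
move=> a x y px py A AS; have [[_ AD] _] := AS.
by apply: AD; [exact: px|exact: py].
Qed.

Lemma meet_Lc p q : Lc p -> Lc q -> Lc (meet p q).
Proof.
move=> [[p0 pD] pc] [[q0 qD] qc]; split; last exact: closedI.
by split=> // a x y [px qx] [py qy]; split; [exact: pD|exact: qD].
Qed.

Lemma join_Lc p q : Lc (join p q).
Proof.
split; last exact: closed_closure.
exact/closure_is_subspace/lspan_is_subspace.
Qed.

Lemma orthocompl_Lc p : Lc (orthocompl p).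
Proof.
split.
  split=> [y _|a x y xp yp z pz]; first by rewrite dotmxE mul0mx mxE.
  by rewrite dotmxE mulmxDl -scalemxAl mxE mxE -!dotmxE xp // yp // mulr0 addr0.
have -> : orthocompl p = \bigcap_(y in p) ((fun x => dotmx x y) @^-1` [set 0]).
  by apply/seteqP; split.
apply: closed_bigI => y _; apply: closed_comp => [x _|]; last first.
  exact: (@accessible_closed_set1 C (hausdorff_accessible (@norm_hausdorff _ C))).
have -> : (fun x => dotmx x y) = (fun x => \sum_j x 0 j * (y 0 j)^* ).
  apply/funext=> z; rewrite dotmxE mxE; apply: eq_bigr => j _.
  by rewrite !mxE.
apply: (@continuous_big C 'I_n +%R 0 predT) => [|j _ {}x]; first exact: add_continuous.
apply: cvgMr_tmp; last exact: coord_continuous.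
exact: (@nbhs_filter _ x).
Qed.

Fixpoint teval (v : nat -> set 'rV[C]_n) (t : term) : set 'rV[C]_n :=
  match t with
  | Var i => v i
  | Meet t1 t2 => meet (teval v t1) (teval v t2)
  | Join t1 t2 => join (teval v t1) (teval v t2)
  | Neg t1 => orthocompl (teval v t1)
  end.

Lemma teval_Lc (v : nat -> set 'rV[C]_n) t :
  (forall i, Lc (v i)) -> Lc (teval v t).
Proof.
move=> Lv; elim: t => //= [t1 L1 t2 L2|t1 _ t2 _|t1 _].
- exact: meet_Lc.
- exact: join_Lc.
- exact: orthocompl_Lc.
Qed.

Definition holds (e : equation) : Prop :=
  forall v : nat -> set 'rV[C]_n, (forall i, Lc (v i)) ->
    teval v e.1 = teval v e.2.

Definition QL : set equation := [set e | holds e].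

End QuantumLogic.

(* Main.v *)
Require Import Defs.
From mathcomp Require Import all_boot all_order all_algebra.
From mathcomp Require Import complex.
From mathcomp Require Import boolp classical_sets reals topology normedtype.
From mathcomp Require Import spectral.
Import GRing.Theory numFieldNormedType.Exports.

Set Implicit Arguments.
Unset Strict Implicit.
Unset Printing Implicit Defensive.

(** The separating equation is Huhn's n-distributive law
    x /\ \/_(i <= n) y_i = \/_(j <= n) (x /\ \/_(i <= n, i != j) y_i).
    If d <= n, it holds in dimension d: a vector of the left-hand side is a sum
    of n+1 vectors u_i in y_i, which are linearly dependent, so that some u_j
    can be absorbed by the others. If d > n, it fails when y_i is the line of
    the i-th basis vector and x is the line of the sum of these vectors. Part
    (2) is the case n = 2^i, and part (1) is part (2) for i = 1. *)

(** Terms have no constant for the zero subspace; this term takes that value under every assignment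
    and so serves as the empty join. *)
Definition Bot : term := Meet (Var 0) (Neg (Var 0)).

Definition huhn_equation (n : nat) : equation :=
  (Meet (Var 0) (\big[Join/Bot]_(i < n.+1) Var i.+1),
   \big[Join/Bot]_(j < n.+1)
     Meet (Var 0) (\big[Join/Bot]_(i < n.+1 | i != j) Var i.+1)).

Local Open Scope ring_scope.
Local Open Scope sesquilinear_scope.
Local Open Scope classical_set_scope.

Section Subspaces.
Variables (C : numClosedFieldType) (n : nat).
Implicit Types (p q : set 'rV[C]_n).

Lemma subspaceZ p a x : is_subspace p -> p x -> p (a *: x).
Proof. by move=> [p0 pD] px; rewrite -[_ *: _]addr0; exact: pD. Qed.

Lemma subspace_sum (I : Type) (r : seq I) (P : pred I) (F : I -> 'rV[C]_n) p :
  is_subspace p -> (forall i, P i -> p (F i)) -> p (\sum_(i <- r | P i) F i).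
Proof.
move=> [p0 pD] pF; elim/big_ind: _ => // x y px py.
by rewrite -[x]scale1r; exact: pD.
Qed.

(** Among the matrices whose row space lies in [p], take one of maximal rank. Adjoining a vector of
    [p] to it cannot raise the rank, so that vector is already in the row space. *)
Lemma subspace_rowspace p : is_subspace p ->
  exists A : 'M[C]_n, forall x, p x <-> (x <= A)%MS.
Proof.
move=> pS; pose inp (A : 'M[C]_n) := forall x, (x <= A)%MS -> p x.
pose P (k : nat) := `[< exists2 A, inp A & \rank A = k >].
have P0 : exists k, P k.
  exists 0%N; apply/asboolP; exists 0; last exact: mxrank0.
  by move=> x; rewrite submx0 => /eqP ->; case: pS.
have Pn k : P k -> (k <= n)%N by move=> /asboolP[A _ <-]; exact: rank_leq_row.
have [k /asboolP[A pA rA] kmax] := ex_maxnP P0 Pn.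
exists A => x; split=> [px|]; last exact: pA.
have pAx : inp (A + x)%MS.
  move=> z /sub_addsmxP[[a b] /= ->].
  have [_ pD] := pS; rewrite -[a *m A]scale1r; apply: pD.
    exact/pA/submxMl.
  by rewrite [b]mx11_scalar mul_scalar_mx; exact: subspaceZ.
have /kmax : P (\rank (A + x)%MS) by apply/asboolP; exists (A + x)%MS.
rewrite -rA => leAxA.
rewrite (submx_trans (addsmxSr A x)) //.
by rewrite -(geq_leqif (mxrank_leqif_sup (addsmxSl A x))).
Qed.

Lemma subspace_Lc p : is_subspace p -> Lc p.
Proof.
move=> pS; have [A pA] := subspace_rowspace pS.
(* The null space of a matrix is an orthogonal complement, hence closed. *)
pose cols : set 'rV[C]_n := range (fun j => (col j (cokermx A))^t* ).
suff -> : p = orthocompl cols by exact: orthocompl_Lc.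
have dotE x j : dotmx x ((col j (cokermx A))^t* ) = (x *m cokermx A) 0 j.
  by rewrite dotmxE trmxCK colE mulmxA -colE mxE.
apply/seteqP; split=> x.
  by move=> /pA; rewrite submxE => /eqP xA y [j _ <-]; rewrite dotE xA mxE.
move=> xA; apply/pA; rewrite submxE; apply/eqP/rowP => j.
by rewrite -dotE mxE; apply: xA; exists j.
Qed.

Lemma sub_joinl p q : p `<=` join p q.
Proof.
move=> x px; apply: subset_closure => A [_ pqA]; apply: pqA; by left.
Qed.

Lemma sub_joinr p q : q `<=` join p q.
Proof.
move=> x qx; apply: subset_closure => A [_ pqA]; apply: pqA; by right.
Qed.

Lemma join_sub p q r : Lc r -> p `<=` r -> q `<=` r -> join p q `<=` r.
Proof.
move=> [rS /closure_id rc] pr qr; rewrite rc.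
by apply: closureS; apply: smallest_sub => // x [/pr|/qr].
Qed.

Lemma meet_orthocompl p : p `&` orthocompl p `<=` [set 0].
Proof. by move=> x [px /(_ x px)/eqP]; rewrite (dnorm_eq0 (@dotmx C n)) => /eqP. Qed.

End Subspaces.

Section BigJoin.
Variables (C : numClosedFieldType) (n : nat) (v : nat -> set 'rV[C]_n).
Variables (I : finType) (P : pred I) (F : I -> term).

Lemma sub_bigjoin i : P i ->
  teval v (F i) `<=` teval v (\big[Join/Bot]_(i | P i) F i).
Proof.
move=> Pi; have := mem_index_enum i.
elim: (index_enum I) => // j r IHr; rewrite inE big_cons.
have [<- _|_ /= ir] := eqVneq; first by rewrite Pi; exact: sub_joinl.
by case: ifP => _ x /(IHr ir) // ?; apply: sub_joinr.
Qed.

Lemma bigjoin_sub q : Lc q -> (forall i, P i -> teval v (F i) `<=` q) ->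
  teval v (\big[Join/Bot]_(i | P i) F i) `<=` q.
Proof.
move=> qL Fq; elim/big_ind: _ => // [x /meet_orthocompl ->|s t sq tq].
  by case: qL => -[].
exact: join_sub.
Qed.

Lemma bigjoin_subspace : (forall i, Lc (v i)) ->
  is_subspace (teval v (\big[Join/Bot]_(i | P i) F i)).
Proof. by move=> vL; case: (teval_Lc (\big[Join/Bot]_(i | P i) F i) vL). Qed.

(** The sums of this form make up a subspace, which is closed because the dimension is finite. It
    contains every [F i], hence their join: taking closures adds no vectors. *)
Lemma bigjoin_sum x : (forall i, Lc (v i)) ->
  teval v (\big[Join/Bot]_(i | P i) F i) x ->
  exists2 u : I -> 'rV[C]_n,
    (forall i, P i -> teval v (F i) (u i)) & x = \sum_(i | P i) u i.
Proof.
move=> vL; pose sums : set 'rV[C]_n := [set x | exists2 u : I -> 'rV[C]_n,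
  (forall i, P i -> teval v (F i) (u i)) & x = \sum_(i | P i) u i].
have FS i : is_subspace (teval v (F i)) by case: (teval_Lc (F i) vL).
suff sL : Lc sums.
  apply: (bigjoin_sub sL) => i Pi {}x Fx.
  exists (fun j => if j == i then x else 0) => [j _|].
    by case: eqP => [->|_] //; case: (FS j).
  by rewrite (bigD1 i) //= eqxx big1 ?addr0 // => j /andP[_ /negPf ->].
apply: subspace_Lc; split.
  by exists (fun=> 0) => [i _|]; [case: (FS i)|rewrite big1].
move=> a _ _ [u Fu ->] [w Fw ->]; exists (fun i => a *: u i + w i).
  by move=> i Pi; case: (FS i) => _; apply; [exact: Fu|exact: Fw].
by rewrite big_split scaler_sumr.
Qed.

End BigJoin.

Section Huhn.
Variable C : numClosedFieldType.

(** The matrix with rows [u i] has rank at most [d < m], so its left kernel contains some [c != 0];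
    solve that relation for a row with nonzero coefficient. *)
Lemma row_dependence m d (u : 'I_m -> 'rV[C]_d) : (d < m)%N ->
  exists j (c : 'I_m -> C), u j = \sum_(i | i != j) c i *: u i.
Proof.
move=> ltdm; pose U := \matrix_i u i.
have /rowV0Pn[c /sub_kermxP cU c0] : kermx U != 0.
  rewrite kermx_eq0 /row_free neq_ltn.
  by rewrite (leq_ltn_trans (rank_leq_col U)).
have [j cj] : exists j, c 0 j != 0 by apply/rV0Pn.
exists j, (fun i => - (c 0 j)^-1 * c 0 i).
have: c *m U = \sum_i c 0 i *: u i.
  by rewrite mulmx_sum_row; apply: eq_bigr => i _; rewrite rowK.
rewrite cU => /esym.
rewrite (bigD1 j) //= => /eqP; rewrite addr_eq0 => /eqP cuj.
rewrite -[u j](scalerK cj) cuj scalerN -scaleNr scaler_sumr.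
by apply: eq_bigr => i _; rewrite scalerA.
Qed.

Lemma huhn_holds n d : (d <= n)%N -> QL C d (huhn_equation n).
Proof.
move=> ledn v vL; have vS i : is_subspace (v i) by case: (vL i).
(* The inclusion of the right-hand side in the left one holds in every lattice; only the converse
   uses the dimension. *)
apply/seteqP; split; last first.
  apply: bigjoin_sub => [|j _ x [xx yx]].
    exact: (teval_Lc (huhn_equation n).1 vL).
  split=> //; apply: bigjoin_sub yx => [|i _]; first exact: teval_Lc.
  exact: sub_bigjoin.
move=> x [xx /(bigjoin_sum vL)[u vu xE]].
(* Here [d <= n] is read as [d < n.+1], the number of vectors [u i]. *)
have [j [c uj]] := @row_dependence n.+1 d u ledn.
apply: (@sub_bigjoin _ _ _ _ _ _ j) => //; split=> //.
(* Now [x] is the sum over [i != j] of [c i *: u i + u i], each summand lying in [v i.+1]. *)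
rewrite xE (bigD1 j) //= uj -big_split /=.
apply: subspace_sum => [|i ij]; first exact: bigjoin_subspace.
apply: (@sub_bigjoin _ _ _ _ _ _ i) => //=.
by case: (vS i.+1) => _; apply; exact: vu.
Qed.

Lemma huhn_fails n d : (n < d)%N -> ~ QL C d (huhn_equation n).
Proof.
move=> ltnd; pose e i : 'rV[C]_d := \row_j (i == j :> nat)%:R.
pose w := \sum_(i < n.+1) e i.
pose v k : set 'rV[C]_d := range (fun a => a *: if k is i.+1 then e i else w).
have vL k : Lc (v k).
  apply: subspace_Lc; split; first by exists 0; rewrite ?scale0r.
  move=> a _ _ [b _ <-] [c _ <-]; exists (a * b + c) => //.
  by rewrite scalerDl scalerA.
have w1 (j : 'I_n.+1) : w 0 (widen_ord ltnd j) = 1.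
  rewrite summxE (bigD1 j) //= mxE eqxx big1 ?addr0 // => i /negPf ij.
  by rewrite mxE /= [_ == _]ij.
have zeroS : is_subspace [set 0 : 'rV[C]_d].
  by split=> // a x y -> ->; rewrite scaler0 addr0.
move=> /(_ v vL) huhn.
(* The vector [w] lies in the left-hand side, while every joinand on the right is zero. *)
suff : teval v (huhn_equation n).2 w.
  move=> /(@bigjoin_sub _ _ _ _ _ _ _ (subspace_Lc zeroS)) wE.
  suff /wE : forall j : 'I_n.+1, true ->
      teval v (Meet (Var 0) (\big[Join/Bot]_(i < n.+1 | i != j) Var i.+1))
        `<=` [set 0].
    by move=> /= w00; have /eqP := w1 ord0; rewrite w00 mxE eq_sym oner_eq0.
  (* The lines of the [e i] with [i != j] lie in the hyperplane where coordinate [j] vanishes. That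
     coordinate of [a *: w] is [a], so [a = 0]. *)
  move=> j _ _ [[a _ <-]] yx.
  have /(_ _ yx) : teval v (\big[Join/Bot]_(i < n.+1 | i != j) Var i.+1)
      `<=` [set x | x 0 (widen_ord ltnd j) = 0].
    apply: bigjoin_sub => [|i ij _ [b _ <-]].
      apply: subspace_Lc; split=> [|b x y /= xj yj]; rewrite /= !mxE //.
      by rewrite xj yj mulr0 addr0.
    by rewrite /= !mxE [_ == _](negPf ij) mulr0.
  by rewrite /= mxE w1 mulr1 => ->; rewrite scale0r.
rewrite -huhn; split; first by exists 1; rewrite ?scale1r.
apply: subspace_sum => [|i _]; first exact: bigjoin_subspace.
by apply: (@sub_bigjoin _ _ _ _ _ _ i) => //; exists 1; rewrite ?scale1r.
Qed.

End Huhn.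

Theorem theorem1 (R : realType) :
  QL (Cplx R) 2 <> QL (Cplx R) 4
  /\
  forall i : nat, exists beta : equation,
    (forall k : nat, (k <= i)%N -> QL (Cplx R) (2 ^ k)%N beta) /\
    (forall l : nat, (i < l)%N -> ~ QL (Cplx R) (2 ^ l)%N beta).
Proof.
split=> [QL24|i].
  apply: (@huhn_fails (Cplx R) 2 4 isT); rewrite -QL24.
  exact: huhn_holds.
exists (huhn_equation (2 ^ i)); split=> [k ki|l il].
  by apply: huhn_holds; rewrite leq_exp2l.
by apply: huhn_fails; rewrite ltn_exp2l.
Qed.
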